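(* Let $n$ be an integer greater than $2$. Then $F(P_2 \square C_n) \geq \left\lceil \frac{n}{2} \right\rceil + 3\left\lfloor \frac{n}{4} \right\rfloor$.
   Context: All graphs are simple, finite and undirected; $P_k$ and $C_k$ are the path and cycle on $k$ vertices. The Cartesian product $G \square H$ has vertex set $V(G)\times V(H)$, with $(u,v)$ adjacent to $(u',v')$ iff either $u=u'$ and $vv'\in E(H)$, or $v=v'$ and $uu'\in E(G)$. Zero forcing: each vertex is blue or white; starting from an initial set $S$ of blue vertices, repeatedly apply the color-change rule: if a blue vertex $u$ has exactly one white neighbor $v$, color $v$ blue. $S$ is a zero forcing set if eventually all vertices are blue, and a failed zero forcing set otherwise. $F(G)$ denotes the maximum cardinality of a failed zero forcing set of $G$. *)

(* Defs.v *)
From mathcomp Require Import all_boot.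

Set Implicit Arguments.
Unset Strict Implicit.
Unset Printing Implicit Defensive.

Record sgraph := SGraph {
  vertex :> finType;
  adj : rel vertex;
  adj_sym : symmetric adj;
  adj_irr : irreflexive adj
}.

Section PathCycle.
Variable k : nat.

Definition path_adj : rel 'I_k :=
  fun i j => (j == i.+1 :> nat) || (i == j.+1 :> nat).

Lemma path_adj_sym : symmetric path_adj.
Proof. by move=> i j; rewrite /path_adj orbC. Qed.

Lemma path_adj_irr : irreflexive path_adj.
Proof. by move=> i; rewrite /path_adj orbb ltn_eqF. Qed.

Definition path_graph : sgraph := SGraph path_adj_sym path_adj_irr.

(* [ordS] is the successor modulo [k].  The guard [i != j] only matters for
   [k = 1]; this is the usual cycle as soon as [2 < k]. *)
Definition cycle_adj : rel 'I_k :=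
  fun i j => (i != j) && ((j == ordS i) || (i == ordS j)).

Lemma cycle_adj_sym : symmetric cycle_adj.
Proof. by move=> i j; rewrite /cycle_adj eq_sym orbC. Qed.

Lemma cycle_adj_irr : irreflexive cycle_adj.
Proof. by move=> i; rewrite /cycle_adj eqxx. Qed.

Definition cycle_graph : sgraph := SGraph cycle_adj_sym cycle_adj_irr.

End PathCycle.

Section CartesianProduct.
Variables G H : sgraph.

Definition cart_adj : rel (G * H)%type :=
  fun x y => ((x.1 == y.1) && adj x.2 y.2) || ((x.2 == y.2) && adj x.1 y.1).

Lemma cart_adj_sym : symmetric cart_adj.
Proof.
by move=> x y; rewrite /cart_adj eq_sym adj_sym [x.2 == _]eq_sym [adj x.1 _]adj_sym.
Qed.

Lemma cart_adj_irr : irreflexive cart_adj.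
Proof. by move=> x; rewrite /cart_adj !adj_irr !andbF. Qed.

Definition cart_prod : sgraph := SGraph cart_adj_sym cart_adj_irr.

End CartesianProduct.

Section ZeroForcing.
Variable G : sgraph.
Implicit Types (S T : {set G}) (u v : G).

Definition white_nbrs S u : {set G} := [set w | adj u w & w \notin S].

Definition forces S u v : bool := (u \in S) && (white_nbrs S u == [set v]).

(* One application of the colour-change rule: [S] and [T] are the sets of blue
   vertices before and after. *)
Definition force_step : rel {set G} :=
  fun S T => [exists u, exists v, forces S u v && (T == v |: S)].

(* [connect] is the reflexive transitive closure. *)
Definition zero_forcing S : bool := connect force_step S [set: G].

Definition failed_zero_forcing S : bool := ~~ zero_forcing S.

(* The maximum ranges over a nonempty family as soon as [G] has a vertex, since
   [set0] is then failed. *)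
Definition failed_zf_number : nat :=
  \max_(S : {set G} | failed_zero_forcing S) #|S|.

End ZeroForcing.

(* Main.v *)
Require Import Defs.
From mathcomp Require Import all_boot.
From mathcomp Require Import zify.

(** It suffices to exhibit a proper set of blue vertices in which every blue
    vertex has either no or at least two white neighbours, so that no force ever
    happens.  Start from the colouring where the white vertices are the [(r, j)]
    with [r] equal to the parity of [j], and recolour blue the white vertex of
    each column [j = 2 mod 4] other than the last column.  A blue vertex off the
    checkerboard has three neighbours on it, at most one of them recoloured,
    and a recoloured vertex has only blue neighbours.  When [n] is odd, the
    vertices off the checkerboard in the columns [n - 1] and [0] have only two
    neighbours on it, but neither is recoloured. *)

Lemma stalled_failed {G : sgraph} {S : {set G}} :
  (forall u v, ~~ forces S u v) -> S != [set: G] -> failed_zero_forcing S.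
Proof.
move=> stalled; apply: contra => /connectP [[|T p] /=]; first by move=> _ ->.
case/andP=> /existsP [u /existsP [v /andP [uv _]]].
by rewrite (negbTE (stalled u v)) in uv.
Qed.

Lemma failed_zf_number_ge {G : sgraph} {S : {set G}} :
  failed_zero_forcing S -> #|S| <= failed_zf_number G.
Proof. by move=> failedS; rewrite /failed_zf_number (bigmax_sup S). Qed.

Lemma forces_uniq {G : sgraph} {S : {set G}} {u v x y : G} :
  forces S u v -> adj u x -> x \notin S -> adj u y -> y \notin S -> x = y.
Proof.
case/andP=> _ /eqP uv ux xS uy yS.
have: x \in white_nbrs S u by rewrite inE ux.
have: y \in white_nbrs S u by rewrite inE uy.
by rewrite uv !inE => /eqP -> /eqP ->.
Qed.

(** No vertex is its own successor here, so the guard [i != j] disappears; spelling out the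
    wrap-around leaves a form that [lia] can handle. *)
Lemma cycle_adjE {n} (i j : 'I_n) : 2 < n ->
  cycle_adj i j = [|| j == i.+1 :> nat, i == j.+1 :> nat,
    (i.+1 == n) && (j == 0 :> nat) | (j.+1 == n) && (i == 0 :> nat)].
Proof.
move=> n2; have ordSE (k : 'I_n) :
  val (ordS k) = if k.+1 == n then 0 else k.+1.
  case: eqP => /= [->|kn]; first by rewrite modnn.
  by rewrite modn_small //; have := ltn_ord k; lia.
rewrite /cycle_adj -!val_eqE !ordSE /=.
have [] := (ltn_ord i, ltn_ord j).
by case: (eqVneq i.+1 n); case: (eqVneq j.+1 n); lia.
Qed.

Section Prism.
Variable n : nat.
Hypothesis n_gt2 : 2 < n.

Let prism := cart_prod (path_graph 2) (cycle_graph n).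

(** If [n] is 3 mod 4, a blue [(0, n - 1)] would have [(0, 0)] as its only white neighbour and would
    force it; hence the guard. *)
Definition recoloured (j : nat) := (j %% 4 == 2) && (j.+1 < n).

Definition prism_blue : {set prism} :=
  [set x : 'I_2 * 'I_n | (x.1 != odd x.2 :> nat) || recoloured x.2].

Lemma in_prism_blue (r : 'I_2) (j : 'I_n) :
  (((r, j) : prism) \in prism_blue) = (r != odd j :> nat) || recoloured j.
Proof. by rewrite inE. Qed.

Lemma prism_adjE (r s : 'I_2) (i j : 'I_n) :
  adj ((r, i) : prism) (s, j) =
    (r == s) && cycle_adj i j || (i == j) && (r != s).
Proof.
rewrite /= /cart_adj /= /path_adj.
by case: r s => [[|[|r]] hr] [[|[|s]] hs].
Qed.

Lemma prism_blue_stalled (u v : prism) : ~~ forces prism_blue u v.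
Proof.
case: u => r i; apply/negP => uv.
have [i_n r_2] := (ltn_ord i, ltn_ord r).
have [ri|ri] := eqVneq (r : nat) (odd i).
  (* A recoloured column is even and interior, so the two columns beside it are odd and blue in row
     0. *)
  case/andP: (uv); rewrite in_prism_blue ri eqxx /= => i_rec /eqP wv.
  have: v \in white_nbrs prism_blue ((r, i) : prism) by rewrite wv set11.
  case: v {uv wv} => s j; rewrite inE prism_adjE in_prism_blue cycle_adjE //.
  rewrite -!val_eqE /=; move: i_rec; rewrite /recoloured.
  by have := (ltn_ord j, ltn_ord s); lia.
have side k (kn : k < n) : cycle_adj i (Ordinal kn) -> odd k != odd i ->
    ~~ recoloured k ->
    adj ((r, i) : prism) (r, Ordinal kn) /\
    ((r, Ordinal kn) : prism) \notin prism_blue.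
  by move=> ik ki k_rec; rewrite prism_adjE in_prism_blue ik eqxx; split=> //=; lia.
(* In a recoloured column, the white neighbours lie in columns [i.-1] and [i.+1], which are odd and
   so not recoloured. *)
have [i_rec|i_nrec] := boolP (recoloured i).
  have ln : i.-1 < n by lia.
  have rn : i.+1 < n by case/andP: i_rec.
  case: (side _ ln); rewrite ?cycle_adjE /recoloured //=;
    rewrite /recoloured in i_rec; try lia; move=> al wl.
  case: (side _ rn); rewrite ?cycle_adjE /recoloured //=; try lia; move=> ar wr.
  by have [] := forces_uniq uv al wl ar wr; lia.
have s_2 : odd i < 2 by case: odd.
have ac : adj ((r, i) : prism) (Ordinal s_2, i).
  by rewrite prism_adjE eqxx -!val_eqE /= ri orbT.
have wc : ((Ordinal s_2, i) : prism) \notin prism_blue.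
  by rewrite in_prism_blue /= eqxx.
(* The vertex across in column [i] is white; column [k] supplies a second one. Away from the last
   column, [i.+1] is 2 mod 4 only if [i] is 1 mod 4, and then [i.-1] is 0 mod 4. *)
have [k [kn [ik ki k_rec]]] : exists k (kn : k < n),
    [/\ cycle_adj i (Ordinal kn), odd k != odd i & ~~ recoloured k].
  have [k [kn [ik [ki k_rec]]]] : exists k, k < n /\
    [|| k == i.+1, i == k.+1 :> nat, (i.+1 == n) && (k == 0)
      | (k.+1 == n) && (i == 0 :> nat)] /\ odd k != odd i /\ ~~ recoloured k.
    rewrite /recoloured; have [i_last|i_nlast] := eqVneq i.+1 n.
      have [i_odd|i_even] := boolP (odd i); first by exists 0; lia.
      by exists i.-1; lia.
    by have [i1|i1] := eqVneq (i %% 4) 1; [exists i.-1|exists i.+1]; lia.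
  by exists k, kn; rewrite cycle_adjE.
have [aw ww] := side k kn ik ki k_rec.
by have [ri' _] := forces_uniq uv ac wc aw ww; move: ri; rewrite -ri' eqxx.
Qed.

Lemma prism_blue_proper : prism_blue != [set: prism].
Proof.
apply/eqP => /setP /(_ (ord0, Ordinal (ltnW (ltnW n_gt2)))).
by rewrite in_prism_blue !inE.
Qed.

Lemma card_prism_blue : n + n %/ 4 <= #|prism_blue|.
Proof.
have ltr (k : 'I_(n %/ 4)) : 4 * k + 2 < n by have := ltn_ord k; lia.
(* The left summand gives the blue vertex off the checkerboard in each column, the right one the
   recoloured vertices, which lie in row 0 as [4 * k + 2] is even. *)
pose f (x : 'I_n + 'I_(n %/ 4)) : prism :=
  match x with
  | inl j => (inord (~~ odd j), j)
  | inr k => (inord 0, Ordinal (ltr k))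
  end.
have f_inj : injective f.
  move=> [j|k] [j'|k'] []; do ?[by move=> _ -> | move=> /(congr1 val) /=];
    rewrite ?inordK ?ltnS ?leq_b1 // => e.
  - by move/(congr1 val) => /= e'; move: e; rewrite e'; lia.
  - by move/(congr1 val) => /= e'; move: e; rewrite -e'; lia.
  - by congr inr; apply: val_inj => /=; lia.
rewrite -[n in n + _]card_ord -[n %/ 4]card_ord -card_sum -(card_imset _ f_inj).
apply/subset_leq_card/subsetP => _ /imsetP [[j|k] _ ->]; rewrite in_prism_blue.
  by rewrite inordK ?ltnS ?leq_b1 //; case: odd.
by rewrite /recoloured /=; have := ltn_ord k; lia.
Qed.

End Prism.

Theorem theorem3p6 (n : nat) (hn : 2 < n) :
  uphalf n + 3 * (n %/ 4) <=
    failed_zf_number (cart_prod (path_graph 2) (cycle_graph n)).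
Proof.
have blueF := stalled_failed (prism_blue_stalled n hn) (prism_blue_proper n hn).
apply: leq_trans (leq_trans (card_prism_blue n hn) (failed_zf_number_ge blueF)).
(* This is [2 * (n %/ 4) <= n./2], since [n] is [uphalf n + n./2]. *)
by lia.
Qed.
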